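(* Let $\varepsilon\in\left(0,\frac{1}{250}\right)$. Then for every $\lambda$ with $\varepsilon<\lambda\leqslant\frac{2}{\sqrt{3}}$ there exists $\pmb{\theta}\in\mathbb{R}^2\setminus\mathbb{Q}^2$ such that (1) $\lambda-\varepsilon\leqslant d^{[2]}_{|\cdot|}(\pmb{\theta})\leqslant\lambda$; and (2) $m_{|\cdot|}(\pmb{\theta})<10^6\,\varepsilon^{-2}$.
   Context: $|\cdot|$ denotes the Euclidean norm on $\mathbb{R}^2$. For $\pmb{\theta}\in\mathbb{R}^2$ and $t\ge1$ put $\psi_{\pmb{\theta}}(t)=\min_{q\in\mathbb{Z}_+,\,q\le t}\min_{\pmb{p}\in\mathbb{Z}^2}|q\pmb{\theta}-\pmb{p}|$ and $d^{[2]}_{|\cdot|}(\pmb{\theta})=\limsup_{t\to\infty} t\,(\psi_{\pmb{\theta}}(t))^2$. For $\pmb{\theta}\notin\mathbb{Q}^2$, the best approximation denominators are the unique integers $q_1=1<q_2<\dots<q_\nu<\dots$ such that $\psi_{\pmb{\theta}}(t)=\psi_{\pmb{\theta}}(q_{\nu-1})$ for $q_{\nu-1}\le t<q_\nu$, and $m_{|\cdot|}(\pmb{\theta})=\limsup_{\nu\to\infty} q_\nu/q_{\nu-1}$. *)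

(* Defs.v *)
From HB Require Import structures.
From mathcomp Require Import all_boot all_order all_algebra.
From mathcomp Require Import all_classical all_reals all_analysis.
From mathcomp Require Import ring lra.

Set Implicit Arguments.
Unset Strict Implicit.
Unset Printing Implicit Defensive.

Import Order.TTheory GRing.Theory Num.Theory.
Import numFieldNormedType.Exports.

Local Open Scope classical_set_scope.
Local Open Scope ring_scope.

Section Definitions.
Variable R : realType.
Implicit Types (x theta : R * R) (t : R) (q : nat -> nat).

(* The library norm `|x| on R * R is the sup norm, hence an explicit one. *)
Definition enorm x : R := Num.sqrt (x.1 ^+ 2 + x.2 ^+ 2).

Definition Q2 : set (R * R) := range (@ratr R) `*` range (@ratr R).

(* Both infima below are minima, see [distZ2_min] and [psi_min]. *)
Definition distZ2 x : R :=
  inf [set enorm (x.1 - p.1%:~R, x.2 - p.2%:~R) | p in [set: int * int]].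

Definition psi theta t : R :=
  inf [set distZ2 (q%:R * theta.1, q%:R * theta.2) |
        q in [set q : nat | (0 < q)%N /\ q%:R <= t]].

Definition d2 theta : \bar R :=
  limf_esup (fun t => (t * psi theta t ^+ 2)%:E) (pinfty_nbhs R).

(* Indexed from 0. Without the last clause the sequence would not be unique:
   q n = n.+1 satisfies all the others. *)
Definition is_best_denominators theta q : Prop :=
  [/\ q 0%N = 1%N,
      forall n, (q n < q n.+1)%N,
      forall n t, (q n)%:R <= t -> t < (q n.+1)%:R ->
        psi theta t = psi theta (q n)%:R
    & forall n, psi theta (q n.+1)%:R < psi theta (q n)%:R].

(* Exists and is unique for theta outside Q2, see [best_denominatorsP] and
   [is_best_denominators_uniq]. *)
Definition best_denominators theta : nat -> nat :=
  xget (fun=> 0%N) [set q | is_best_denominators theta q].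

Definition m_ratio theta : \bar R :=
  limn_esup (fun n => ((best_denominators theta n.+1)%:R /
                       (best_denominators theta n)%:R : R)%:E).

End Definitions.

Section Facts.
Variable R : realType.
Implicit Types (x theta : R * R) (t : R) (q : nat -> nat).

Lemma enorm_ge0 x : 0 <= enorm x. Proof. exact: sqrtr_ge0. Qed.

Lemma enorm_le x y :
  `|x.1| <= `|y.1| -> `|x.2| <= `|y.2| -> enorm x <= enorm y.
Proof.
move=> h1 h2; rewrite /enorm ler_sqrt; last by rewrite addr_ge0 ?sqr_ge0.
by rewrite -(real_normK (num_real x.1)) -(real_normK (num_real x.2))
  -(real_normK (num_real y.1)) -(real_normK (num_real y.2)) lerD // lerXn2r
  ?nnegrE.
Qed.

Lemma enorm_le_add x : enorm x <= `|x.1| + `|x.2|.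
Proof.
rewrite /enorm -[leRHS]ger0_norm ?addr_ge0 // -sqrtr_sqr ler_sqrt ?sqr_ge0 //.
rewrite -(real_normK (num_real x.1)) -(real_normK (num_real x.2)) sqrrD.
have : 0 <= `|x.1| * `|x.2| by rewrite mulr_ge0.
by lra.
Qed.

Lemma enorm_eq0 x : enorm x = 0 -> x.1 = 0 /\ x.2 = 0.
Proof.
move=> /eqP; rewrite /enorm sqrtr_eq0 => h.
have h1 := sqr_ge0 x.1; have h2 := sqr_ge0 x.2.
by split; apply/eqP; rewrite -sqrf_eq0; apply/eqP; lra.
Qed.

Lemma nearest_int (a : R) :
  exists r : int, forall p : int, `|a - r%:~R| <= `|a - p%:~R|.
Proof.
exists (Num.floor (a + 2^-1)) => p; set r := Num.floor _.
have h1 : r%:~R <= a + 2^-1 by exact: Num.Theory.floor_le.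
have h2 : a + 2^-1 < r%:~R + 1.
  by have := floorD1_gt (a + 2^-1); rewrite -/r intrD.
have h3 : `|a - r%:~R| <= 2^-1 by rewrite ler_norml; apply/andP; split; lra.
case: (ltgtP r p) => [|| ->//]; rewrite -lezD1 -(ler_int R) intrD => h.
  by rewrite [leRHS]ler0_norm; lra.
by rewrite [leRHS]ger0_norm; lra.
Qed.

Lemma distZ2_le x (p : int * int) :
  distZ2 x <= enorm (x.1 - p.1%:~R, x.2 - p.2%:~R).
Proof.
apply: ge_inf; last by exists p.
by exists 0 => _ [p' _ <-]; exact: enorm_ge0.
Qed.

Lemma distZ2_min x :
  exists p : int * int, distZ2 x = enorm (x.1 - p.1%:~R, x.2 - p.2%:~R).
Proof.
have [r1 h1] := nearest_int x.1; have [r2 h2] := nearest_int x.2.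
exists (r1, r2); apply/eqP; rewrite eq_le distZ2_le /=.
apply: lb_le_inf; first by exists (enorm (x.1 - 0%:~R, x.2 - 0%:~R)), (0, 0).
by move=> _ [[p1 p2] _ <-]; apply: enorm_le => /=.
Qed.

Lemma distZ2_ge0 x : 0 <= distZ2 x.
Proof. by have [p ->] := distZ2_min x; exact: enorm_ge0. Qed.

Lemma psi_le theta t (q : nat) : (0 < q)%N -> q%:R <= t ->
  psi theta t <= distZ2 (q%:R * theta.1, q%:R * theta.2).
Proof.
move=> q0 qt; apply: ge_inf; last by exists q.
by exists 0 => _ [p' _ <-]; exact: distZ2_ge0.
Qed.

Lemma psi_min theta t : 1 <= t -> exists q : nat,
  [/\ (0 < q)%N, q%:R <= t
    & psi theta t = distZ2 (q%:R * theta.1, q%:R * theta.2)].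
Proof.
move=> t1; have t0 : 0 <= t by lra.
have n0 : (0 < Num.truncn t)%N by rewrite truncn_ge_nat.
pose F (i : 'I_(Num.truncn t)) :=
  distZ2 ((i.+1)%:R * theta.1, (i.+1)%:R * theta.2).
case: (@arg_minP _ _ _ (Ordinal n0) predT F isT) => i _ hi.
have it : (i.+1)%:R <= t by rewrite -truncn_ge_nat.
exists i.+1; split=> //; apply/eqP; rewrite eq_le psi_le //=.
apply: lb_le_inf; first by exists (F i), i.+1.
move=> _ [[|q] /= [q0 qt] <-] //.
have qn : (q < Num.truncn t)%N by rewrite truncn_ge_nat.
exact: (hi (Ordinal qn) isT).
Qed.

Lemma psi_truncn theta t : 0 <= t -> psi theta t = psi theta (Num.truncn t)%:R.
Proof.
move=> t0; congr (inf (_ @` _)); apply/seteqP; split=> q /= [q0 qt];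
  split=> //; move: qt; by rewrite ler_nat truncn_ge_nat.
Qed.

Lemma psi_nincr theta s t : 1 <= s -> s <= t -> psi theta t <= psi theta s.
Proof.
move=> s1 st; have [q [q0 qs ->]] := psi_min theta s1.
by rewrite psi_le // (le_trans qs).
Qed.

Lemma psi_gt0 theta t : ~ Q2 theta -> 1 <= t -> 0 < psi theta t.
Proof.
move=> thQ t1; have [q [q0 _ ->]] := psi_min theta t1.
rewrite lt_def distZ2_ge0 andbT; apply/negP => /eqP h; apply: thQ.
have [p hp] := distZ2_min (q%:R * theta.1, q%:R * theta.2).
move: hp; rewrite h => /esym/enorm_eq0 /= [e1 e2].
have qR : q%:R != 0 :> R by rewrite pnatr_eq0 -lt0n.
split.
  exists (p.1%:~R / q%:R) => //; rewrite fmorph_div /= ratr_int ratr_nat.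
  by apply: (mulfI qR); rewrite mulrC divfK //; lra.
exists (p.2%:~R / q%:R) => //; rewrite fmorph_div /= ratr_int ratr_nat.
by apply: (mulfI qR); rewrite mulrC divfK //; lra.
Qed.

Lemma pigeonhole_approx theta (N : nat) : exists q : nat, (0 < q)%N /\
  distZ2 (q%:R * theta.1, q%:R * theta.2) <= 2 / N.+1%:R.
Proof.
pose fr (a : R) : R := a - (Num.floor a)%:~R.
have fr0 a : 0 <= fr a by rewrite subr_ge0 Num.Theory.floor_le.
have fr1 a : fr a < 1.
  by have := floorD1_gt a; rewrite /fr intrD; lra.
have N0 : 0 < N.+1%:R :> R by rewrite ltr0n.
have B0 a : 0 <= N.+1%:R * fr a by rewrite mulr_ge0 // ltW.
pose b (a : R) : 'I_N.+1 := inord (Num.truncn (N.+1%:R * fr a)).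
have bE a : b a = Num.truncn (N.+1%:R * fr a) :> nat.
  rewrite inordK // truncn_lt_nat //.
  by rewrite -[ltRHS]mulr1 ltr_pM2l.
have close a c : b a = b c -> `|fr a - fr c| <= N.+1%:R^-1.
  move=> /(congr1 (@nat_of_ord _)); rewrite !bE => e.
  have /andP[a1 a2] := truncn_itv (B0 a); have /andP[c1 c2] := truncn_itv (B0 c).
  rewrite -(ler_pM2l N0) -[X in X * `|_|](ger0_norm (ltW N0)) -normrM divff ?gt_eqF //.
  rewrite mulrBr ler_norml; move: a1 a2 c1 c2; rewrite e -natr1 => a1 a2 c1 c2.
  by apply/andP; split; lra.
pose f (k : 'I_(N.+1 * N.+1).+1) := (b (k%:R * theta.1), b (k%:R * theta.2)).
have /injectivePn[k [l kl fkl]] : ~~ injectiveb f.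
  by apply/injectiveP => /leq_card; rewrite card_prod !card_ord ltnn.
wlog kl' : k l kl fkl / (k < l)%N.
  move=> W; case: (ltngtP k l) => [h|h|h]; first exact: (W k l).
    by apply: (W l k) => //; rewrite eq_sym.
  by move: kl; rewrite -val_eqE /= h eqxx.
exists (l - k)%N; split; first by rewrite subn_gt0.
case: fkl => e1 e2.
have E (a : R) : (l - k)%:R * a -
    (Num.floor (l%:R * a) - Num.floor (k%:R * a))%:~R =
    fr (l%:R * a) - fr (k%:R * a).
  by rewrite /fr natrB ?(ltnW kl') // rmorphB /=; ring.
apply: le_trans (distZ2_le _
  (Num.floor (l%:R * theta.1) - Num.floor (k%:R * theta.1),
   Num.floor (l%:R * theta.2) - Num.floor (k%:R * theta.2))) _.
apply: le_trans (enorm_le_add _) _; rewrite [X in X <= _]/= !E.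
rewrite mulrDl mul1r; apply: lerD; exact: close.
Qed.

Lemma psi_drop theta (n : nat) : ~ Q2 theta -> (0 < n)%N ->
  exists k : nat, (n < k)%N && (psi theta k%:R < psi theta n%:R).
Proof.
move=> thQ n0; have n1 : 1 <= n%:R :> R by rewrite ler1n.
have p0 := psi_gt0 thQ n1.
have [q [q0 hq]] := pigeonhole_approx theta (Num.truncn (2 / psi theta n%:R)).
have hlt : distZ2 (q%:R * theta.1, q%:R * theta.2) < psi theta n%:R.
  apply: le_lt_trans hq _; rewrite ltr_pdivrMr ?ltr0n // mulrC -ltr_pdivrMr //.
  exact: truncnS_gt.
have h : psi theta q%:R < psi theta n%:R by apply: le_lt_trans (psi_le _ q0 _) hlt.
exists q; rewrite h andbT ltnNge; apply/negP => qn.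
by move: h; rewrite ltNge psi_nincr // ?ler1n // ler_nat.
Qed.

Lemma is_best_denominators_ex theta :
  ~ Q2 theta -> exists q, is_best_denominators theta q.
Proof.
move=> thQ.
have step (n : {n : nat | (0 < n)%N}) : {k : {n : nat | (0 < n)%N} |
  [/\ (val n < val k)%N, psi theta (val k)%:R < psi theta (val n)%:R
    & forall j : nat, (val n < j)%N ->
        psi theta j%:R < psi theta (val n)%:R -> (val k <= j)%N]}.
  have [k /andP[k1 k2] kmin] := ex_minnP (psi_drop thQ (valP n)).
  have k0 : (0 < k)%N by exact: leq_ltn_trans k1.
  by exists (exist _ k k0); split=> //= j j1 j2; apply: kmin; rewrite j1 j2.
pose u n := iter n (fun z => sval (step z)) (exist _ 1%N (ltn0Sn 0)).
exists (fun n => val (u n)); split=> //.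
- by move=> n /=; case: (svalP (step (u n))).
- move=> n t t1 t2; case: (svalP (step (u n))) => _ _ kmin.
  have u1 : 1 <= (val (u n))%:R :> R by rewrite ler1n; exact: valP.
  have t0 : 0 <= t by lra.
  apply/eqP; rewrite eq_le psi_nincr //= (psi_truncn theta t0) leNgt; apply/negP => lt.
  have : (val (u n) <= Num.truncn t)%N by rewrite truncn_ge_nat.
  rewrite leq_eqVlt => /orP[/eqP e|h]; first by move: lt; rewrite e ltxx.
  have := kmin _ h lt; rewrite truncn_ge_nat //.
  by move: t2 => /=; rewrite ltNge => /negP.
- by move=> n /=; case: (svalP (step (u n))).
Qed.

Lemma is_best_denominators_uniq theta q q' :
  is_best_denominators theta q -> is_best_denominators theta q' -> q = q'.
Proof.
move=> hq hq'; apply/funext; elim=> [|n IH]; first by case: hq hq' => -> _ _ _ [->].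
wlog lt : q q' hq hq' IH / (q n.+1 < q' n.+1)%N.
  by move=> W; case: (ltngtP (q n.+1) (q' n.+1)) => // h; [|apply/esym];
     apply: W.
case: hq hq' => _ inc _ dec [_ _ cst _].
have := cst n (q n.+1)%:R; rewrite ltr_nat ler_nat -IH => /(_ (ltnW (inc n)) lt) e.
by have := dec n; rewrite e ltxx.
Qed.

Lemma best_denominatorsP theta :
  ~ Q2 theta -> is_best_denominators theta (best_denominators theta).
Proof. by move=> thQ; exact: xgetPex (is_best_denominators_ex thQ). Qed.

End Facts.

(* Main.v *)
Require Import Defs.
From mathcomp Require Import all_boot all_order all_algebra.
From mathcomp Require Import all_classical all_reals all_analysis.
From mathcomp Require Import ring lra.

Import Order.TTheory GRing.Theory Num.Theory.

Local Open Scope ring_scope.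

(* For an integer vector z = (q, p) the projection of Z^3 along z is a plane
   lattice of covolume 1 / q; if theta is very close to p / q and the shortest
   vector of that lattice has squared length a / q, then t psi(t)^2 is close to
   a for t just below q. Starting from a basis (x, y, z) of Z^3, the next basis
   is (y, z, z') with z' = c z + k y + x. The integer k, of size 1 / eps, makes
   q' / q of order eps^-2, and then c is chosen so that the projection of z
   along z' has squared length a' / q' with a' slightly below lambda and the
   next row of the lattice is shifted by nearly half of this vector. The latter
   makes it almost a shortest vector as long as a'^2 <= 4 / 3, which is the
   hexagonal bound lambda <= 2 / sqrt 3. The points p / q converge to theta. *)

(** * Lattices projected along an integer vector, and the extension of a basis *)

Section Lattice.
Set Implicit Arguments.
Unset Strict Implicit.
Variable R : realType.
Implicit Types (x y z v : int * int * int) (u w : R * R).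

Definition dot u w : R := u.1 * w.1 + u.2 * w.2.

Definition det3 x y z : int :=
  x.1.1 * (y.1.2 * z.2 - y.2 * z.1.2) - x.1.2 * (y.1.1 * z.2 - y.2 * z.1.1)
  + x.2 * (y.1.1 * z.1.2 - y.1.2 * z.1.1).

(* [z.1.1] times the projection of [v] along [z] onto the plane [q = 0], a
   triple [(q, p1, p2)] being stored as [((q, p1), p2)] *)
Definition shadow z v : R * R :=
  ((z.1.1 * v.1.2 - v.1.1 * z.1.2)%:~R, (z.1.1 * v.2 - v.1.1 * z.2)%:~R).

Lemma dot_combl (t : R) u w :
  dot (- (t * u.1 + w.1), - (t * u.2 + w.2)) u = - (t * dot u u + dot u w).
Proof. by rewrite /dot /=; ring. Qed.

Lemma dot_comb (t : R) u w :
  let c := (- (t * u.1 + w.1), - (t * u.2 + w.2)) in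
  dot c c = t ^+ 2 * dot u u + 2 * t * dot u w + dot w w.
Proof. by rewrite /dot /=; ring. Qed.

(** When [det3 x y z = 1], the shadows of [y] and [x] span a lattice of covolume [z.1.1], in
    accordance with covolume [1 / z.1.1] before the scaling by [z.1.1]. *)
Lemma shadow_det3 x y z :
  (shadow z y).1 * (shadow z x).2 - (shadow z y).2 * (shadow z x).1 =
  - (z.1.1 * det3 x y z)%:~R.
Proof.
move: x y z => [[x0 x1] x2] [[y0 y1] y2] [[z0 z1] z2].
rewrite /shadow /det3 /= -!rmorphM -!rmorphB -rmorphN /=; congr (_%:~R); ring.
Qed.

(** Cramer's rule writes [v] in the basis [x, y, z], and [shadow z] kills the [z] component. *)
Lemma shadow_decomp x y z v : det3 x y z = 1 ->
  let a := (det3 x v z)%:~R in let b := (det3 v y z)%:~R in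
  shadow z v = (a * (shadow z y).1 + b * (shadow z x).1,
                a * (shadow z y).2 + b * (shadow z x).2) :> R * R.
Proof.
move: x y z v => [[x0 x1] x2] [[y0 y1] y2] [[z0 z1] z2] [[v0 v1] v2] h /=.
rewrite /shadow /= -!rmorphM -!rmorphD /=; congr (_%:~R, _%:~R).
  rewrite -[LHS]mulr1 -h /det3 /=; ring.
rewrite -[LHS]mulr1 -h /det3 /=; ring.
Qed.

Lemma det3_cramer x y z v : det3 x y z = 1 -> det3 x v z = 0 -> det3 v y z = 0 ->
  v.1.1 = det3 x y v * z.1.1.
Proof.
move=> h ha hb; have := esym (mulr1 v.1.1); rewrite -h => ->.
have -> : v.1.1 * det3 x y z =
  det3 v y z * x.1.1 + det3 x v z * y.1.1 + det3 x y v * z.1.1.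
  by rewrite /det3; ring.
by rewrite ha hb !mul0r !add0r.
Qed.

Lemma int_ge1_sqr (a : int) : a != 0 -> 1 <= a%:~R ^+ 2 :> R.
Proof.
move=> a0; rewrite -rmorphXn /= ler1z.
by rewrite -gtz0_ge1 exprn_even_gt0.
Qed.

Lemma int_small_or_large (b : int) : b != 0 ->
  (b = 1 \/ b = -1) \/ (2 <= b \/ b <= -2).
Proof.
case: b => [[|[|n]]|[|n]] // _; [left; left|right; left|left; right|right; right] => //.
Qed.

Lemma int_above (a : R) : exists c : int, a <= c%:~R <= a + 1.
Proof.
exists (Num.floor a + 1); rewrite intrD.
have := floorD1_gt a; have := Num.Theory.floor_le a; rewrite intrD; lra.
Qed.

Lemma half_offset (s sg : R) (N a : int) : 0 <= sg <= 1/2 ->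
  N%:~R + 1/2 - sg <= s <= N%:~R + 1/2 -> (1/2 - sg) ^+ 2 <= (a%:~R + s) ^+ 2.
Proof.
move=> /andP[s0 s1] /andP[h1 h2].
have [h|h] := lerP 0 (a + N).
  have : 0 <= (a + N)%:~R :> R by rewrite ler0z.
  by rewrite intrD => h'; nra.
have : (a + N + 1)%:~R <= 0 :> R by rewrite lerz0 lezD1.
by rewrite !intrD => h'; nra.
Qed.

(** In orthogonal coordinates along [shadow z y], a lattice vector with coefficients [a, b] has
    squared length [((a + b s)^2 alpha + b^2 / alpha) q]. For [b = 0] the range of [v.1.1] forces
    [a != 0]. For [b = 1] or [-1] the offset contributes [(1/2 - sg)^2 alpha] and the height
    [1 / alpha >= 3/4 alpha], which add up to at least [(1 - sg) alpha]. For larger [b] the height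
    alone suffices. *)
Lemma shadow_min x y z v (alpha s sg : R) (N : int) :
  det3 x y z = 1 -> 0 < z.1.1 -> 0 < alpha -> 3 * alpha ^+ 2 <= 4 ->
  dot (shadow z y) (shadow z y) = alpha * z.1.1%:~R ->
  dot (shadow z y) (shadow z x) = s * (alpha * z.1.1%:~R) ->
  0 <= sg <= 1/2 -> N%:~R + 1/2 - sg <= s <= N%:~R + 1/2 ->
  0 < v.1.1 < z.1.1 ->
  (1 - sg) * (alpha * z.1.1%:~R) <= dot (shadow z v) (shadow z v).
Proof.
move=> hd z0 a0 a43 hE hEF hsg hs /andP[v0 vz].
set q : R := z.1.1%:~R in hE hEF *.
have q0 : 0 < q by rewrite ltr0z.
pose a := det3 x v z; pose b := det3 v y z.
set A : R := a%:~R; set B : R := b%:~R.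
have key : dot (shadow z v) (shadow z v) =
    ((A + B * s) ^+ 2 * alpha + B ^+ 2 / alpha) * q.
  have aq : alpha * q != 0 by rewrite mulf_neq0 // gt_eqF.
  apply: (mulfI aq).
  have -> : alpha * q * (((A + B * s) ^+ 2 * alpha + B ^+ 2 / alpha) * q) =
     (A * (alpha * q) + B * (s * (alpha * q))) ^+ 2 + B ^+ 2 * q ^+ 2.
    by field; rewrite gt_eqF.
  have -> : q ^+ 2 = ((shadow z y).1 * (shadow z x).2 -
                      (shadow z y).2 * (shadow z x).1) ^+ 2.
    by rewrite shadow_det3 hd mulr1 sqrrN.
  rewrite -hEF -hE (@shadow_decomp x y z v hd) -/a -/b -/A -/B /dot /=; ring.
rewrite key mulrA ler_pM2r //.
have ia : 3 / 4 * alpha <= alpha^-1 by rewrite -[alpha^-1]mul1r ler_pdivlMr //; lra.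
case/andP: (hsg) => sg0 sg1.
have [b0|bn0] := eqVneq b 0.
  have a1 : a != 0.
    apply/eqP => a0'; have := @det3_cramer x y z v hd a0' b0.
    move=> e; move: v0 vz; rewrite e pmulr_lgt0 // gtz0_ge1 => h.
    by rewrite -[X in _ < X]mul1r ltr_pM2r // ltNge h.
  have := int_ge1_sqr a1; rewrite /B b0 -/A; nra.
have [hb|hb] := int_small_or_large bn0.
  have B2 : B ^+ 2 = 1 by rewrite /B; case: hb => ->; rewrite ?rmorphN /=; ring.
  have : (1/2 - sg) ^+ 2 <= (A + B * s) ^+ 2.
    case: hb => hb; rewrite /B hb.
      by rewrite (mul1r s); exact: half_offset hsg hs.
    have -> : (A + (-1)%:~R * s) ^+ 2 = ((- a)%:~R + s) ^+ 2.
      by rewrite !rmorphN /= -/A; ring.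
    exact: half_offset hsg hs.
  rewrite B2 mul1r; nra.
have : 4 <= B ^+ 2.
  case: hb; rewrite -(ler_int R) -/B => hb; nra.
have := sqr_ge0 (A + B * s); nra.
Qed.

(* The next vector is [z' = c z + k y + x]. The integer [k] fixes the length of
   [shadow z z'], about [K0] times that of [shadow z y]. Increasing [c] by one
   changes [z'.1.1] by [z.1.1] and shifts by [sg], at most [1 / K0], the offset
   of the second row of the lattice projected along [z'], so that both can be
   tuned. *)
Lemma next_vector x y z (alpha mu lam K0 : R) :
  det3 x y z = 1 -> 0 < z.1.1 -> 0 < alpha ->
  dot (shadow z y) (shadow z y) = alpha * z.1.1%:~R ->
  0 < mu < lam -> 3 * lam ^+ 2 <= 4 -> 2 <= K0 ->
  2 * lam * mu <= (lam - mu) * K0 * alpha ->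
  exists z' (alpha' K : R),
    [/\ det3 y z z' = 1, 0 < z'.1.1,
        dot (shadow z' z) (shadow z' z) = alpha' * z'.1.1%:~R &
        mu <= alpha' <= lam] /\
    [/\ K0 <= K <= K0 + 1,
        z'.1.1%:~R * alpha' = z.1.1%:~R * (K ^+ 2 * alpha + alpha^-1) &
        forall v, 0 < v.1.1 < z'.1.1 ->
          (1 - K0^-1) * (alpha' * z'.1.1%:~R) <= dot (shadow z' v) (shadow z' v)].
Proof.
move=> hd z0 a0 hE /andP[mu0 mulam] lam43 hK0 hK.
set q : R := z.1.1%:~R in hE *.
have q0 : 0 < q by rewrite ltr0z.
have lam0 : 0 < lam by lra.
set E : R * R := shadow z y in hE; set F : R * R := shadow z x.
have EF : (E.1 * F.2 - E.2 * F.1) ^+ 2 = q ^+ 2.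
  by rewrite shadow_det3 hd mulr1 sqrrN.
pose s := dot E F / (alpha * q).
have hs : dot E F = s * (alpha * q) by rewrite /s divfK // mulf_neq0 // gt_eqF.
(* Lagrange's identity, the determinant of [E] and [F] being [q] up to sign. *)
have hF : dot F F = (s ^+ 2 * alpha + alpha^-1) * q.
  apply: (mulfI (x := alpha * q)); first by rewrite mulf_neq0 // gt_eqF.
  have -> : alpha * q * ((s ^+ 2 * alpha + alpha^-1) * q) =
     (s * (alpha * q)) ^+ 2 + q ^+ 2 by field; rewrite gt_eqF.
  by rewrite -hs -hE -EF /dot; ring.
have [k hk] := int_above (K0 - s).
pose K := k%:~R + s.
have hKK : K0 <= K <= K0 + 1 by rewrite /K; lra.
case/andP: (hKK) => K1 K2.
(* [B * q] is the squared length of [k E + F], which is [- shadow z' z] whatever [c] is; [K] is its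
   coordinate along [E]. *)
pose B := K ^+ 2 * alpha + alpha^-1.
have ia0 : 0 < alpha^-1 by rewrite invr_gt0.
have BK : K * (K * alpha) <= B by rewrite /B; nra.
have Ka : 0 < K * alpha by rewrite mulr_gt0 //; lra.
have B0 : 0 < B by nra.
pose sg := K * alpha / B.
have sg0 : 0 < sg by rewrite divr_gt0.
have sgK : sg <= K0^-1.
  by rewrite ler_pdivrMr // ler_pdivlMl; [nra|lra].
have sgV : sg^-1 = B / (K * alpha) by rewrite /sg invf_div.
(* The quotient [q' / q] may range from [B / lam] to [B / mu]. This window must hold the [sg^-1]
   steps in which the offset runs through a full period, plus one for rounding to an integer. *)
have room : B / lam + sg^-1 + 1 <= B / mu.
  have e1 : B / mu - B / lam = B * ((lam - mu) / (lam * mu)) by field; rewrite !gt_eqF.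
  have d1 : 2 / (K * alpha) <= (lam - mu) / (lam * mu).
    rewrite ler_pdivrMr // mulrAC ler_pdivlMr ?mulr_gt0 //.
    have : 0 <= (lam - mu) * alpha * (K - K0) by rewrite !mulr_ge0 //; lra.
    lra.
  have e2 : B * (2 / (K * alpha)) = 2 * sg^-1 by rewrite sgV; ring.
  have e3 : 1 <= sg^-1.
    rewrite sgV ler_pdivlMr // mul1r; nra.
  have := ler_wpM2l (ltW B0) d1; rewrite e2 -e1; lra.
(* As functions of [c], the quotient [q' / q] is [c + r0 / q] and the new offset is [g - c * sg]; at
   the real value [c0] the quotient equals [B / lam]. *)
pose r0 := (k * y.1.1 + x.1.1)%R.
pose g := (y.1.1%:~R - r0%:~R * sg) / q.
pose c0 := B / lam - r0%:~R / q.
(* [m] is the real solution of [g - m * sg = N + 1/2], and this [N] puts it between [c0] and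
   [c0 + sg^-1]. Rounding [m] up to [c] lowers the offset by at most [sg]. *)
have [N hN] := int_above (g - c0 * sg - 3/2).
pose m := (g - N%:~R - 1/2) / sg.
have [c hc] := int_above m.
have msg : m * sg = g - N%:~R - 1/2 by rewrite /m divfK // gt_eqF.
have m1 : c0 <= m by rewrite -(ler_pM2r sg0) msg; lra.
have m2 : m <= c0 + sg^-1.
  by rewrite -(ler_pM2r sg0) msg mulrDl mulVf ?gt_eqF //; lra.
pose z' : int * int * int :=
  ((c * z.1.1 + k * y.1.1 + x.1.1, c * z.1.2 + k * y.1.2 + x.1.2),
   c * z.2 + k * y.2 + x.2).
set q' : R := z'.1.1%:~R.
have q'E : q' = (c%:~R + r0%:~R / q) * q.
  by rewrite [RHS]mulrDl divfK ?gt_eqF // /q' /z' /r0 /= !intrD !intrM -/q addrA.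
have qq1 : B / lam <= q' / q by rewrite q'E mulfK ?gt_eqF //; rewrite /c0 in m1; lra.
have qq2 : q' / q <= B / mu by rewrite q'E mulfK ?gt_eqF //; rewrite /c0 in m2; lra.
have qq0 : 0 < q' / q by apply: lt_le_trans qq1; rewrite divr_gt0.
have q'0 : 0 < q' by move: qq0; rewrite pmulr_lgt0 // invr_gt0.
pose alpha' := q * B / q'.
have al1 : alpha' <= lam.
  rewrite /alpha' ler_pdivrMr //.
  by move: qq1; rewrite ler_pdivlMr // mulrAC ler_pdivrMr //; lra.
have al2 : mu <= alpha'.
  rewrite /alpha' ler_pdivlMr //.
  by move: qq2; rewrite ler_pdivrMr // mulrAC ler_pdivlMr //; lra.
have al0 : 0 < alpha' by lra.
have alq : alpha' * q' = q * B by rewrite /alpha' divfK // gt_eqF.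
have E'1 : shadow z' z = (- (k%:~R * E.1 + F.1), - (k%:~R * E.2 + F.2)).
  by rewrite /E /F /shadow /z' /=; congr (_, _); ring.
have hd' : det3 y z z' = 1 by rewrite -hd /det3 /z' /=; ring.
have hE' : dot (shadow z' z) (shadow z' z) = alpha' * q'.
  by rewrite alq E'1 dot_comb hE hs hF /B /K; ring.
(* The vector [q y - y.1.1 z] has first coordinate 0 and remaining coordinates [E], so [shadow z']
   merely multiplies it by [q']. *)
have F'1 : q * (shadow z' y).1 = q' * E.1 + y.1.1%:~R * (shadow z' z).1.
  by rewrite /E /shadow /q /q' /=; ring.
have F'2 : q * (shadow z' y).2 = q' * E.2 + y.1.1%:~R * (shadow z' z).2.
  by rewrite /E /shadow /q /q' /=; ring.
have hEF' : dot (shadow z' z) (shadow z' y) = (g - c%:~R * sg) * (alpha' * q').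
  apply: (mulfI (x := q)); first by rewrite gt_eqF.
  transitivity (q' * dot (shadow z' z) E + y.1.1%:~R * dot (shadow z' z) (shadow z' z)).
    rewrite /dot; transitivity ((shadow z' z).1 * (q * (shadow z' y).1)
      + (shadow z' z).2 * (q * (shadow z' y).2)); first by ring.
    by rewrite F'1 F'2; ring.
  have -> : dot (shadow z' z) E = - (sg * (q * B)).
    by rewrite E'1 dot_combl hE hs /sg /K; field; rewrite gt_eqF.
  rewrite hE' alq /g q'E; field; rewrite gt_eqF //.
exists z', alpha', K; split; first split=> //.
- by rewrite -(ltr0z R).
- by rewrite al1 al2.
split=> //; first by rewrite mulrC alq.
move=> v hv; apply: le_trans (_ : (1 - sg) * (alpha' * q') <= _).
  by apply: ler_wpM2r; [rewrite mulr_ge0 // ltW|rewrite lerD2l lerN2].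
apply: (@shadow_min y z z' v alpha' (g - c%:~R * sg) sg N) => //.
- by rewrite -(ltr0z R).
- nra.
- rewrite ltW //=; apply: le_trans sgK _; rewrite div1r lef_pV2 ?posrE //; lra.
- case/andP: hc => cm1 cm2.
  have := ler_wpM2r (ltW sg0) cm1; have := ler_wpM2r (ltW sg0) cm2.
  by rewrite mulrDl msg mul1r => h1 h2; apply/andP; split; lra.
Qed.

End Lattice.

(** * From distance bounds along a sequence of denominators to [d2] and [m_ratio] *)

Section FromApproximations.
Set Implicit Arguments.
Unset Strict Implicit.
Variable R : realType.
Implicit Types (theta x y : R * R) (q : nat -> nat) (L Z : nat -> R).

Lemma enorm_sqr x : enorm x ^+ 2 = x.1 ^+ 2 + x.2 ^+ 2.
Proof. by rewrite sqr_sqrtr // addr_ge0 ?sqr_ge0. Qed.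

Lemma ler_of_sqr (a b : R) : 0 <= b -> a ^+ 2 <= b ^+ 2 -> a <= b.
Proof. by move=> b0 h; rewrite leNgt; apply/negP => ba; nra. Qed.

Lemma enormD x y : enorm (x.1 + y.1, x.2 + y.2) <= enorm x + enorm y.
Proof.
have x0 := enorm_ge0 x; have y0 := enorm_ge0 y.
have xy : x.1 * y.1 + x.2 * y.2 <= enorm x * enorm y.
  have [h|h] := lerP (x.1 * y.1 + x.2 * y.2) 0.
    by apply: le_trans h _; rewrite mulr_ge0.
  apply: ler_of_sqr; rewrite ?mulr_ge0 // exprMn !enorm_sqr.
  have := sqr_ge0 (x.1 * y.2 - x.2 * y.1); lra.
apply: ler_of_sqr; first by rewrite addr_ge0.
by rewrite sqrrD !enorm_sqr /=; lra.
Qed.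

Lemma enormZ (c : R) x : 0 <= c -> enorm (c * x.1, c * x.2) = c * enorm x.
Proof.
by move=> c0; rewrite /enorm /= !exprMn -mulrDr sqrtrM ?sqr_ge0 // sqrtr_sqr ger0_norm.
Qed.

Lemma increasing_geq q n : (forall n, q n < q n.+1)%N -> (n <= q n)%N.
Proof. by move=> inc; elim: n => // n IH; apply: leq_ltn_trans IH (inc n). Qed.

Lemma increasing_bracket q m : (forall n, q n < q n.+1)%N -> (q 0 <= m)%N ->
  exists n, (q n <= m < q n.+1)%N.
Proof.
move=> inc; elim: m => [|m IH] h0.
  by exists 0%N; rewrite h0 /=; apply: leq_ltn_trans (inc 0%N).
move: h0; rewrite leq_eqVlt => /orP[/eqP h|]; first by exists 0%N; rewrite -h leqnn inc.
rewrite ltnS => /IH[n /andP[n1 n2]].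
have [h|h] := ltnP m.+1 (q n.+1); first by exists n; rewrite h (leq_trans n1).
have e : q n.+1 = m.+1 by apply/eqP; rewrite eqn_leq h n2.
by exists n.+1; rewrite h -e inc.
Qed.

Lemma psi_ge theta (N : nat) (l t : R) :
  (forall j : nat, (0 < j < N)%N -> l <= distZ2 (j%:R * theta.1, j%:R * theta.2)) ->
  1 <= t -> t < N%:R -> l <= psi theta t.
Proof.
move=> H t1 tN; have [j [j0 jt ->]] := psi_min theta t1.
by apply: H; rewrite j0 -(ltr_nat R) (le_lt_trans jt).
Qed.

Lemma Q2_distZ2_eq0 theta : Q2 theta ->
  exists2 j : nat, (0 < j)%N & distZ2 (j%:R * theta.1, j%:R * theta.2) = 0.
Proof.
case: theta => t1 t2 [/= [a _ <-] [b _ <-]].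
have den (c : rat) : `|denq c|%:R = (denq c)%:~R :> R.
  by rewrite pmulrn abszE ger0_norm // denq_ge0.
have num (c : rat) : (denq c)%:~R * ratr c = (numq c)%:~R :> R.
  by rewrite /ratr mulrC divfK // intr_eq0 denq_neq0.
exists (`|denq a| * `|denq b|)%N; first by rewrite muln_gt0 !absz_gt0 !denq_neq0.
apply/eqP; rewrite eq_le distZ2_ge0 andbT.
apply: le_trans (distZ2_le _ (denq b * numq a, denq a * numq b)%R) _.
rewrite /= natrM !den !intrM -!num /enorm /=.
have -> : (denq a)%:~R * (denq b)%:~R * ratr a
   - (denq b)%:~R * ((denq a)%:~R * ratr a) = 0 :> R by ring.
have -> : (denq a)%:~R * (denq b)%:~R * ratr b
   - (denq a)%:~R * ((denq b)%:~R * ratr b) = 0 :> R by ring.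
by rewrite expr0n addr0 sqrtr0.
Qed.

(** A rational point has an integral multiple [j * theta] with [j > 0], and [j] lies below
    [q j.+1]. *)
Lemma not_Q2 theta q L : (forall n, q n < q n.+1)%N -> (forall n, 0 < L n) ->
  (forall n j : nat, (0 < j < q n)%N ->
     L n <= distZ2 (j%:R * theta.1, j%:R * theta.2)) ->
  ~ Q2 theta.
Proof.
move=> inc L0 lb /Q2_distZ2_eq0[j j0 hj].
have := lb j.+1 j; rewrite j0 (leq_trans _ (increasing_geq _ inc)) // hj leNgt.
by rewrite L0 => /(_ isT).
Qed.

(** For [t] between [q n] and [q n.+1], [psi] is at most [Z n] while [t] is below [q n.+1]. *)
Lemma d2_le theta q Z (lam : R) : (forall n, q n < q n.+1)%N -> (0 < q 0)%N ->
  (forall n, distZ2 ((q n)%:R * theta.1, (q n)%:R * theta.2) <= Z n) ->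
  (forall n, (q n.+1)%:R * Z n ^+ 2 <= lam) ->
  (d2 theta <= lam%:E)%E.
Proof.
move=> inc q00 ub hZ; apply: ge_ereal_inf.
exists (ereal_sup [set ((t * psi theta t ^+ 2)%:E) | t in [set t : R | (q 0%N)%:R < t]]).
  exists [set t : R | (q 0%N)%:R < t]%classic => //.
  by exists (q 0%N)%:R; split => //; exact: num_real.
apply: ge_ereal_sup => _ [t /= q0t <-]; rewrite lee_fin.
have t0 : 0 <= t by apply: le_trans (ltW q0t).
have [n /andP[n1 n2]] : exists n, (q n <= Num.truncn t < q n.+1)%N.
  by apply: increasing_bracket => //; rewrite truncn_ge_nat // ltW.
have qn0 : (0 < q n)%N by elim: (n) => // m IH; apply: leq_trans (ltnW (inc m)).
have h1 : psi theta t <= Z n.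
  by apply: le_trans (ub n); apply: psi_le => //; rewrite -truncn_ge_nat.
have p0 : 0 <= psi theta t.
  have t1 : 1%:R <= t by rewrite -truncn_ge_nat // (leq_trans qn0).
  by have [j [_ _ ->]] := psi_min theta t1; exact: distZ2_ge0.
apply: le_trans (hZ n); apply: ler_pM => //; first exact: sqr_ge0.
  by rewrite ltW // -truncn_lt_nat.
by rewrite lerXn2r ?nnegrE // (le_trans p0).
Qed.

(** Sampling at [t = (1 - e) * q n], just below [q n], keeps [psi] at least [L n]. *)
Lemma d2_ge theta q L (lam e : R) : (forall n, q n < q n.+1)%N ->
  (forall n j : nat, (0 < j < q n)%N ->
     L n <= distZ2 (j%:R * theta.1, j%:R * theta.2)) ->
  0 < e < 1 -> (forall n, 0 < L n) ->
  (forall n, lam <= (1 - e) * ((q n)%:R * L n ^+ 2)) ->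
  (lam%:E <= d2 theta)%E.
Proof.
move=> inc lb /andP[e0 e1] L0 hL; apply: le_ereal_inf_tmp => _ [V [M [_ MV]] <-].
(* At [t >= 1] the infimum defining [psi] is over a nonempty set and is attained. *)
pose M' := Num.max M 1.
have e10 : 0 < 1 - e by lra.
pose n := (Num.truncn (M' / (1 - e))).+1.
have hM : M' < (1 - e) * (q n)%:R.
  rewrite mulrC -ltr_pdivrMr //; apply: lt_le_trans (truncnS_gt _) _.
  by rewrite ler_nat increasing_geq.
have [M1 M2] : M <= M' /\ 1 <= M' by rewrite /M' !le_max !lexx orbT.
pose t := (1 - e) * (q n)%:R.
have t1 : 1 <= t by apply/ltW/(le_lt_trans M2 hM).
apply: (@le_trans _ _ (t * psi theta t ^+ 2)%:E); last first.
  by apply: ereal_sup_ubound; exists t => //; apply: MV; apply: le_lt_trans M1 hM.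
rewrite lee_fin; apply: le_trans (hL n) _.
rewrite mulrA -/t ler_pM2l; last exact: lt_le_trans t1.
have q0 : 0 < (q n)%:R :> R.
  by apply: lt_le_trans (_ : n%:R <= _); rewrite ?ltr0n // ler_nat increasing_geq.
have hp : L n <= psi theta t by apply: psi_ge (lb n) _ _ => //; rewrite /t; nra.
have l0 := ltW (L0 n).
by rewrite lerXn2r ?nnegrE // (le_trans l0).
Qed.

(** The [q n] need not be the best denominators. But if [q k <= b n < q k.+1], then [psi] has
    dropped strictly by [q k.+1] because [Z k.+1 < L k.+1], so
    [b n.+1 <= q k.+1 <= C * q k <= C * b n]. *)
Lemma m_ratio_le theta q Z L (C : R) : (forall n, q n < q n.+1)%N -> (0 < q 0)%N ->
  (forall n, (q n.+1)%:R <= C * (q n)%:R) ->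
  (forall n, distZ2 ((q n)%:R * theta.1, (q n)%:R * theta.2) <= Z n) ->
  (forall n j : nat, (0 < j < q n)%N ->
     L n <= distZ2 (j%:R * theta.1, j%:R * theta.2)) ->
  (forall n, Z n < L n) -> ~ Q2 theta ->
  (m_ratio theta <= C%:E)%E.
Proof.
move=> inc q00 hC ub lb ZL thQ.
have [b0 binc bcst _] := best_denominatorsP thQ.
set b := best_denominators theta in b0 binc bcst *.
have bpos n : (0 < b n)%N by elim: n => [|n IH]; [rewrite b0|apply: leq_trans (binc n)].
have step n : (q 0 <= b n)%N -> (b n.+1)%:R <= C * (b n)%:R :> R.
  move=> h; have [k /andP[k1 k2]] := increasing_bracket inc h.
  apply: (@le_trans _ _ (q k.+1)%:R).
    rewrite ler_nat leqNgt; apply/negP => h2.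
    have := bcst n (q k.+1)%:R; rewrite ler_nat ltr_nat => /(_ (ltnW k2) h2) e.
    have : psi theta (q k.+1)%:R <= Z k.+1.
      by apply: le_trans (ub k.+1); apply: psi_le => //; apply: leq_ltn_trans (inc k).
    rewrite e leNgt => /negP; apply; apply: lt_le_trans (ZL k.+1) _.
    by apply: psi_ge (lb k.+1) _ _; rewrite ?ler1n ?ltr_nat.
  apply: le_trans (hC k) _.
  have C0 : 0 <= C.
    have := hC 0%N; have : 0 < (q 1%N)%:R :> R.
      by rewrite ltr0n (leq_ltn_trans _ (inc 0%N)).
    have : 0 < (q 0%N)%:R :> R by rewrite ltr0n.
    by move=> h1 h3 h4; rewrite ltW // -(pmulr_lgt0 _ h1) (lt_le_trans h3).
  by rewrite ler_wpM2l // ler_nat.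
apply: ge_ereal_inf; eexists.
  by exists [set n | (q 0 <= n)%N]%classic; [exists (q 0%N)|].
apply: ge_ereal_sup => _ [n /= hn <-]; rewrite lee_fin ler_pdivrMr ?ltr0n //.
by apply: step; apply: leq_trans hn (increasing_geq _ binc).
Qed.
End FromApproximations.

(** * The infinite chain of bases and its limit point *)

Section Limit.
Set Implicit Arguments.
Unset Strict Implicit.
Variable R : realType.

(** The intervals of radius [2 * D n] about [u n] are nested. *)
Lemma geometric_limit (u D : nat -> R) :
  (forall n, 0 <= D n) -> (forall n, D n.+1 <= D n / 2) ->
  (forall n, `|u n.+1 - u n| <= D n) ->
  exists l, forall n, `|l - u n| <= 2 * D n.
Proof.
move=> D0 hD hu.
have step n : u n - 2 * D n <= u n.+1 - 2 * D n.+1 /\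
              u n.+1 + 2 * D n.+1 <= u n + 2 * D n.
  by have := hu n; have := hD n; rewrite ler_norml => h1 /andP[h2 h3]; split; lra.
have mono (n k : nat) : u n - 2 * D n <= u (n + k)%N - 2 * D (n + k)%N /\
              u (n + k)%N + 2 * D (n + k)%N <= u n + 2 * D n.
  elim: k => [|k [h1 h2]]; first by rewrite addn0.
  by rewrite addnS; have [h3 h4] := step (n + k)%N; split; lra.
have cross m n : u m - 2 * D m <= u n + 2 * D n.
  have [h1 _] := mono m n; have [_ h2] := mono n m.
  by rewrite addnC in h2; have := D0 (m + n)%N; lra.
pose S : set R := range (fun n => u n - 2 * D n).
have ubS n : ubound S (u n + 2 * D n) by move=> _ [m _ <-]; exact: cross.
exists (sup S) => n; rewrite ler_norml.
have h1 : u n - 2 * D n <= sup S.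
  by apply: ub_le_sup; [exists (u n + 2 * D n)|exists n].
have h2 : sup S <= u n + 2 * D n.
  by apply: ge_sup => //; exists (u n - 2 * D n), n.
by apply/andP; split; lra.
Qed.

Lemma enorm_norml (x : R * R) : `|x.1| <= enorm x.
Proof.
apply: ler_of_sqr; first exact: enorm_ge0.
by rewrite enorm_sqr real_normK ?num_real // lerDl sqr_ge0.
Qed.

Lemma enorm_normr (x : R * R) : `|x.2| <= enorm x.
Proof.
apply: ler_of_sqr; first exact: enorm_ge0.
by rewrite enorm_sqr real_normK ?num_real // lerDr sqr_ge0.
Qed.

(** This turns lengths in the projected lattice into approximation errors at the rational point
    given by [z]. *)
Lemma shadow_enorm (z v : int * int * int) : 0 < z.1.1 ->
  dot (shadow R z v) (shadow R z v) = z.1.1%:~R ^+ 2 *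
   enorm (v.1.1%:~R * (z.1.2%:~R / z.1.1%:~R) - v.1.2%:~R,
          v.1.1%:~R * (z.2%:~R / z.1.1%:~R) - v.2%:~R) ^+ 2.
Proof.
move=> z0; rewrite enorm_sqr /dot /shadow /= !rmorphB !rmorphM /=.
have : z.1.1%:~R != 0 :> R by rewrite intr_eq0 gt_eqF.
by move=> h; field.
Qed.

(** The data kept from the chain of bases [(x, y, z)]: [q n] and [p n] are the coordinates of [z],
    [x n] is the point [p n / q n], and [a n] is the [alpha] of the basis. *)
Record tame_approx (mu lam K0 : R) (q : nat -> nat) (p : nat -> int * int)
    (a : nat -> R) (x : nat -> R * R) : Prop := TameApprox {
  tame_q0 : forall n, (0 < q n)%N;
  tame_x : forall n, (q n)%:R * (x n).1 = (p n).1%:~R /\ (q n)%:R * (x n).2 = (p n).2%:~R;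
  tame_a : forall n, mu <= a n <= lam;
  tame_q : forall n, exists2 K, K0 <= K <= K0 + 1 &
     (q n.+1)%:R * a n.+1 = (q n)%:R * (K ^+ 2 * a n + (a n)^-1);
  tame_gap : forall n,
     (q n.+1)%:R * enorm ((q n)%:R * (x n.+1).1 - (p n).1%:~R,
            (q n)%:R * (x n.+1).2 - (p n).2%:~R) ^+ 2 = a n.+1;
  tame_min : forall n (j : nat) (P : int * int), (0 < j < q n)%N ->
     (1 - K0^-1) * a n <= (q n)%:R * enorm (j%:R * (x n).1 - P.1%:~R,
            j%:R * (x n).2 - P.2%:~R) ^+ 2 }.

Lemma tame_approx_ex (mu lam K0 : R) : 0 < mu < lam -> 3 * lam ^+ 2 <= 4 ->
  2 <= K0 -> 4 * lam <= (lam - mu) * K0 ->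
  exists q p a x, tame_approx mu lam K0 q p a x.
Proof.
move=> hml lam43 hK0 hK; case/andP: (hml) => mu0 mulam.
pose V3 := (int * int * int)%type.
pose good (t : V3 * V3 * V3 * R) := let '(x, y, z, al) := t in
  [/\ det3 x y z = 1, 0 < z.1.1,
      dot (shadow R z y) (shadow R z y) = al * z.1.1%:~R, mu <= al <= lam &
      forall v : V3, 0 < v.1.1 < z.1.1 ->
          (1 - K0^-1) * (al * z.1.1%:~R) <= dot (shadow R z v) (shadow R z v)].
pose rel (t t' : V3 * V3 * V3 * R) := t'.1.1.2 = t.1.2 /\
  exists2 K, K0 <= K <= K0 + 1 & t'.1.2.1.1%:~R * t'.2 =
     t.1.2.1.1%:~R * (K ^+ 2 * t.2 + (t.2)^-1).
have lam2 : lam <= 2 by nra.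
(* The standard basis has [alpha = 1], which may lie outside the range from [mu] to [lam]; the chain
   starts one step later. *)
have [t0 ht0] : exists t, good t.
  have [|//|//||//|//|//||z' [al' [K [[h1 h2 h3 h4] [h5 h6 h7]]]]] :=
    @next_vector R ((0, 1), 0) ((0, 0), 1) ((1, 0), 0) 1 mu lam K0.
  - by [].
  - by rewrite /dot /shadow /=; ring.
  - nra.
  by exists (((0, 0), 1), ((1, 0), 0), z', al').
have next (t : {t | good t}) : {t' : {t | good t} | rel (sval t) (sval t')}.
  apply: cid; case: t => -[[[x y] z] al] /= [h1 h2 h3 h4 h5].
  case/andP: (h4) => al1 al2.
  have [||||||||z' [al' [K [[k1 k2 k3 k4] [k5 k6 k7]]]]] :=
    @next_vector R x y z al mu lam K0 => //.
  - lra.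
  - nra.
  have g : good (y, z, z', al') by [].
  by exists (exist _ _ g); split => //; exists K.
pose u n := sval (iter n (fun t => sval (next t)) (exist _ t0 ht0)).
have gu n : good (u n) by exact: svalP.
have ru n : rel (u n) (u n.+1) by exact: (svalP (next _)).
clearbody u.
pose z n := (u n).1.2; pose a n := (u n).2.
have uE n : u n = ((u n).1.1.1, (u n).1.1.2, z n, a n).
  by rewrite /z /a; case: (u n) => -[[]].
pose q n := `|(z n).1.1|%N.
have z0 n : 0 < (z n).1.1 by have := gu n; rewrite uE => -[].
have qz n : (q n)%:Z = (z n).1.1 by rewrite /q abszE gtr0_norm.
have qE n : (q n)%:R = (z n).1.1%:~R :> R by rewrite -qz pmulrn.
have q0 n : 0 < (q n)%:R :> R by rewrite qE ltr0z.
exists q, (fun n => ((z n).1.2, (z n).2)), a,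
  (fun n => ((z n).1.2%:~R / (z n).1.1%:~R, (z n).2%:~R / (z n).1.1%:~R)).
split=> n /=.
- by rewrite -(ltr0n R).
- have h : (z n).1.1%:~R != 0 :> R by rewrite intr_eq0 gt_eqF.
  by rewrite qE; split; rewrite mulrC divfK.
- by have := gu n; rewrite uE => -[].
- by rewrite !qE; case: (ru n).
- have := gu n.+1; rewrite uE => -[_ _ + _ _]; case: (ru n) => -> _.
  rewrite -/(z n) shadow_enorm // -!qE expr2 -!mulrA [RHS]mulrC.
  by move=> /(mulfI (lt0r_neq0 (q0 n.+1))).
- move=> j [P1 P2] /andP[j0 jq]; have := gu n; rewrite uE => -[_ _ _ _].
  move=> /(_ ((j%:Z, P1), P2)) /=; rewrite -qz !ltz_nat j0 jq => /(_ isT).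
  rewrite qz shadow_enorm // -!qE /= -pmulrn.
  set e := enorm _; rewrite expr2 mulrA -[X in _ <= X]mulrA [X in _ <= X]mulrC.
  by rewrite ler_pM2r.
Qed.

(** By [tame_gap], the value at [n.+1] is the distance from [q n * x n.+1] to [p n]. *)
Definition tame_radius (q : nat -> nat) (a : nat -> R) n : R := Num.sqrt (a n / (q n)%:R).

Section TameTheory.
Variables (mu lam K0 : R) (q : nat -> nat) (p : nat -> int * int).
Variables (a : nat -> R) (x : nat -> R * R).
Hypotheses (T : tame_approx mu lam K0 q p a x) (mu0 : 0 < mu).
Hypotheses (lam_mu : lam <= 3 * mu) (K0_ge : 24 <= K0).
Local Notation r := (tame_radius q a).

Let q0 n : 0 < (q n)%:R :> R.
Proof. by rewrite ltr0n; exact: tame_q0 T n. Qed.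

Let a0 n : 0 < a n.
Proof. by have /andP[h _] := tame_a T n; exact: lt_le_trans h. Qed.

Let a3 m n : a m <= 3 * a n.
Proof.
have /andP[h1 h2] := tame_a T n; have /andP[h3 h4] := tame_a T m.
by have := lam_mu; lra.
Qed.

Lemma tame_radius_gt0 n : 0 < r n.
Proof. by rewrite sqrtr_gt0 divr_gt0. Qed.

Lemma tame_radius_sqr n : (q n)%:R * r n ^+ 2 = a n.
Proof. by rewrite sqr_sqrtr ?ltW ?divr_gt0 // mulrC divfK // gt_eqF. Qed.

Lemma tame_growth n : K0 ^+ 2 * a n * (q n)%:R <= (q n.+1)%:R * a n.+1.
Proof.
have [K /andP[K1 _] ->] := tame_q T n.
have : 0 < (a n)^-1 by rewrite invr_gt0.
have : K0 ^+ 2 <= K ^+ 2 by rewrite lerXn2r ?nnegrE //; have := K0_ge; lra.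
move=> h1 h2; rewrite mulrC ler_pM2l //.
have := ler_wpM2r (ltW (a0 n)) h1; lra.
Qed.

Lemma tame_incr n : (q n < q n.+1)%N.
Proof.
rewrite -(ltr_nat R) ltNge; apply/negP => h.
have h1 := tame_growth n; have h2 := ler_pM (ltW (q0 n.+1)) (ltW (a0 n.+1)) h (a3 n.+1 n).
have h3 : 0 < (q n)%:R * a n by rewrite mulr_gt0.
have h4 : 24 * 24 <= K0 ^+ 2 by have := K0_ge; nra.
have := ler_wpM2r (ltW h3) h4; lra.
Qed.

Lemma tame_ratio n :
  (q n.+1)%:R <= 3 * ((K0 + 1) ^+ 2 + mu^-1 ^+ 2) * (q n)%:R.
Proof.
have [K /andP[K1 K2] e] := tame_q T n.
have /andP[am _] := tame_a T n.
have ia : (a n)^-1 <= mu^-1 by rewrite lef_pV2 ?posrE.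
have ia0 : 0 < (a n)^-1 by rewrite invr_gt0.
have h1 : K ^+ 2 <= (K0 + 1) ^+ 2 by rewrite lerXn2r ?nnegrE //; have := K0_ge; lra.
have h2 : (a n)^-1 ^+ 2 <= mu^-1 ^+ 2 by rewrite lerXn2r ?nnegrE // ltW // invr_gt0.
have h3 : K ^+ 2 * a n + (a n)^-1 = a n * (K ^+ 2 + (a n)^-1 ^+ 2).
  by field; rewrite gt_eqF.
rewrite -(ler_pM2r (a0 n.+1)) e h3.
have h4 : K ^+ 2 + (a n)^-1 ^+ 2 <= (K0 + 1) ^+ 2 + mu^-1 ^+ 2 by exact: lerD.
have h5 : 0 <= K ^+ 2 + (a n)^-1 ^+ 2 by rewrite addr_ge0 ?sqr_ge0.
have h6 := ler_pM (ltW (a0 n)) h5 (a3 n n.+1) h4.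
have := ler_wpM2l (ltW (q0 n)) h6; lra.
Qed.

(** By [tame_growth] the squared quotient is at most [(a n.+1 / (K0 * a n))^2], and
    [a n.+1 <= 3 * a n]. *)
Lemma tame_radius_step n : r n.+1 <= 3 / K0 * r n.
Proof.
have K00 : 0 < K0 by have := K0_ge; lra.
apply: ler_of_sqr; first by rewrite mulr_ge0 ?divr_ge0 ?ltW ?tame_radius_gt0.
have hK : 0 < K0 ^+ 2 by rewrite exprn_gt0.
have e m : r m ^+ 2 = a m / (q m)%:R.
  by apply: (mulfI (lt0r_neq0 (q0 m))); rewrite tame_radius_sqr mulrC divfK ?gt_eqF.
have -> : (3 / K0 * r n) ^+ 2 = 9 * a n / (K0 ^+ 2 * (q n)%:R).
  by rewrite exprMn e; field; rewrite !gt_eqF.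
rewrite e ler_pdivrMr // mulrAC ler_pdivlMr ?mulr_gt0 //.
rewrite -(ler_pM2r (a0 n.+1)).
have h1 := ler_wpM2l (ltW (a0 n)) (tame_growth n).
have h2 := ler_pM (ltW (a0 n.+1)) (ltW (a0 n.+1)) (a3 n.+1 n) (a3 n.+1 n).
have h3 := ler_wpM2r (mulr_ge0 (ltW hK) (ltW (q0 n))) h2.
lra.
Qed.

(** [theta] is the limit of [x n]. The upper bound compares [q n * theta] with [q n * x n.+1], the
    lower one [j * theta] with [j * x n]. *)
Lemma tame_limit : exists theta : R * R,
  (forall n, distZ2 ((q n)%:R * theta.1, (q n)%:R * theta.2)
               <= (1 + 12 / K0) * r n.+1) /\
  (forall n j : nat, (0 < j < q n)%N ->
     (1 - 7 / K0) * r n <= distZ2 (j%:R * theta.1, j%:R * theta.2)).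
Proof.
have K00 : 0 < K0 by have := K0_ge; lra.
have iK : 0 < K0^-1 by rewrite invr_gt0.
have iK24 : K0^-1 <= 24^-1 by rewrite lef_pV2 ?posrE.
(* [D n] is the distance from [x n] to [x n.+1]. *)
pose D n := r n.+1 / (q n)%:R.
have D0 n : 0 <= D n by rewrite ltW // divr_gt0 // tame_radius_gt0.
have qD n : (q n)%:R * D n = r n.+1 by rewrite mulrC divfK // gt_eqF.
have qD1 n : (q n)%:R * D n.+1 <= 3 / K0 * r n.+1.
  apply: le_trans (tame_radius_step n.+1); rewrite -qD ler_wpM2r //.
  by rewrite ler_nat ltnW // tame_incr.
have hD n : D n.+1 <= D n / 2.
  rewrite -(ler_pM2l (q0 n)) [leRHS]mulrA qD; apply: le_trans (qD1 n) _.
  by have := tame_radius_gt0 n.+1; nra.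
have gap n : enorm ((q n)%:R * (x n.+1).1 - (p n).1%:~R,
                    (q n)%:R * (x n.+1).2 - (p n).2%:~R) = r n.+1.
  rewrite /tame_radius -(tame_gap T n) mulrAC divff ?gt_eqF // mul1r sqrtr_sqr.
  by rewrite ger0_norm // enorm_ge0.
have [t1 ht1] : exists l, forall n, `|l - (x n).1| <= 2 * D n.
  apply: geometric_limit => // n; rewrite -(ler_pM2l (q0 n)) qD.
  rewrite -[X in X * `|_|](ger0_norm (ltW (q0 n))) -normrM mulrBr.
  by rewrite (proj1 (tame_x T n)) -(gap n); exact: (enorm_norml (_, _)).
have [t2 ht2] : exists l, forall n, `|l - (x n).2| <= 2 * D n.
  apply: geometric_limit => // n; rewrite -(ler_pM2l (q0 n)) qD.
  rewrite -[X in X * `|_|](ger0_norm (ltW (q0 n))) -normrM mulrBr.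
  by rewrite (proj2 (tame_x T n)) -(gap n); exact: (enorm_normr (_, _)).
have near n : enorm (t1 - (x n).1, t2 - (x n).2) <= 4 * D n.
  by apply: le_trans (enorm_le_add _) _ => /=; have := ht1 n; have := ht2 n; lra.
have ub n : enorm ((q n)%:R * t1 - (p n).1%:~R, (q n)%:R * t2 - (p n).2%:~R)
              <= (1 + 12 / K0) * r n.+1.
  have := enormD ((q n)%:R * (x n.+1).1 - (p n).1%:~R,
                  (q n)%:R * (x n.+1).2 - (p n).2%:~R)
     ((q n)%:R * (t1 - (x n.+1).1), (q n)%:R * (t2 - (x n.+1).2)).
  rewrite gap (enormZ (t1 - (x n.+1).1, t2 - (x n.+1).2) (ltW (q0 n))) /=.
  have -> : (q n)%:R * (x n.+1).1 - (p n).1%:~R + (q n)%:R * (t1 - (x n.+1).1) =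
            (q n)%:R * t1 - (p n).1%:~R by ring.
  have -> : (q n)%:R * (x n.+1).2 - (p n).2%:~R + (q n)%:R * (t2 - (x n.+1).2) =
            (q n)%:R * t2 - (p n).2%:~R by ring.
  have := ler_wpM2l (ltW (q0 n)) (near n.+1); have := qD1 n; lra.
exists (t1, t2); split=> [n|n j hj] /=.
  by apply: le_trans (ub n); exact: (distZ2_le (_, _) (p n)).
have [P ->] := distZ2_min (j%:R * t1, j%:R * t2); rewrite /=.
have := enormD (j%:R * t1 - P.1%:~R, j%:R * t2 - P.2%:~R)
   (j%:R * ((x n).1 - t1), j%:R * ((x n).2 - t2)).
rewrite (enormZ ((x n).1 - t1, (x n).2 - t2) (ler0n R j)) /=.
have -> : j%:R * t1 - P.1%:~R + j%:R * ((x n).1 - t1) = j%:R * (x n).1 - P.1%:~R by ring.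
have -> : j%:R * t2 - P.2%:~R + j%:R * ((x n).2 - t2) = j%:R * (x n).2 - P.2%:~R by ring.
have -> : enorm ((x n).1 - t1, (x n).2 - t2) = enorm (t1 - (x n).1, t2 - (x n).2).
  by rewrite /enorm /= -(sqrrN (_ - t1)) -(sqrrN (_ - t2)) !opprB.
have jq : j%:R <= (q n)%:R :> R by case/andP: hj => _ h; rewrite ler_nat ltnW.
(* As [j < q n], the shift is at most the error of [q n * theta], hence at most [2 * r n.+1].
   Together with the loss [1 / K0] from [tame_min] this makes [7 / K0]. *)
have far : j%:R * enorm (t1 - (x n).1, t2 - (x n).2) <= 6 / K0 * r n.
  have rs := tame_radius_step n; have rn := tame_radius_gt0 n.
  have rn1 := tame_radius_gt0 n.+1.
  apply: (@le_trans _ _ (2 * r n.+1)); last lra.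
  apply: le_trans (ler_wpM2r (enorm_ge0 _) jq) _.
  rewrite -(enormZ _ (ltW (q0 n))) /= !mulrBr (proj1 (tame_x T n)) (proj2 (tame_x T n)).
  by apply: le_trans (ub n) _; nra.
have low : (1 - K0^-1) * r n <=
    enorm (j%:R * (x n).1 - P.1%:~R, j%:R * (x n).2 - P.2%:~R).
  apply: ler_of_sqr; first exact: enorm_ge0.
  rewrite -(ler_pM2l (q0 n)); apply: le_trans (tame_min T P hj).
  rewrite exprMn mulrCA tame_radius_sqr ler_pM2r //; nra.
lra.
Qed.

End TameTheory.
End Limit.

(** * Choice of the constants in terms of [eps] *)

Theorem theorem2 (R : realType) (eps : R)
    (heps0 : 0 < eps) (heps1 : eps < 1 / 250) (lambda : R)
    (hlambda0 : eps < lambda) (hlambda1 : lambda <= 2 / Num.sqrt 3) :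
  exists theta : R * R,
    [/\ ~ Q2 theta,
        ((lambda - eps)%:E <= d2 theta <= lambda%:E)%E
      & (m_ratio theta < (10 ^+ 6 * eps ^- 2)%:E)%E].
Proof.
have l43 : 3 * lambda ^+ 2 <= 4.
  have s0 : 0 < Num.sqrt 3 :> R by rewrite sqrtr_gt0.
  have s3 : Num.sqrt 3 ^+ 2 = 3 :> R by rewrite sqr_sqrtr.
  move: hlambda1; rewrite ler_pdivlMr // => h.
  have l0 : 0 <= lambda * Num.sqrt 3 by rewrite mulr_ge0 //; lra.
  have -> : 3 * lambda ^+ 2 = (lambda * Num.sqrt 3) * (lambda * Num.sqrt 3).
    by rewrite -[X in X * _]s3; ring.
  have := ler_pM l0 l0 h h; lra.
have l2 : lambda <= 6 / 5 by nra.
(* A margin of [eps / 4] remains on either side for the relative errors of order [1 / K0], which are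
   small multiples of [eps]. *)
pose mu := lambda - 3 / 4 * eps; pose lam := lambda - eps / 4.
pose K0 := 200 / eps.
have ie0 : 0 < eps^-1 by rewrite invr_gt0.
have iee : eps * eps^-1 = 1 by rewrite divff // gt_eqF.
have ie250 : 250 <= eps^-1 by nra.
have mu0 : 0 < mu by rewrite /mu; lra.
have lam43 : 3 * lam ^+ 2 <= 4 by rewrite /lam; nra.
have K0_24 : 24 <= K0 by rewrite /K0; lra.
have [q [p [a [x T]]]] : exists q p a x, tame_approx mu lam K0 q p a x.
  apply: tame_approx_ex => //; first by rewrite /mu /lam; lra.
    lra.
  have -> : (lam - mu) * K0 = 100 by rewrite /lam /mu /K0; field; rewrite gt_eqF.
  by rewrite /lam; lra.
have lam_mu : lam <= 3 * mu by rewrite /lam /mu; lra.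
have KV : K0^-1 = eps / 200 by rewrite /K0 invf_div.
have inc := tame_incr T mu0 lam_mu K0_24.
have rgt0 := tame_radius_gt0 T mu0; have rsqr := tame_radius_sqr T mu0.
have rstep := tame_radius_step T mu0 lam_mu K0_24.
have [theta [ub lb]] := tame_limit T mu0 lam_mu K0_24.
rewrite KV in ub lb rstep.
have L0 n : 0 < (1 - 7 * (eps / 200)) * tame_radius q a n by rewrite mulr_gt0 //; lra.
have thQ : ~ Q2 theta := not_Q2 inc L0 lb.
have ha n := tame_a T n.
exists theta; split=> //.
  apply/andP; split.
    (* To first order the relative loss is [eps / 20 + 14 * eps / 200 = 3 / 25 * eps]; as
       [lambda <= 6 / 5], it fits into the margin. *)
    apply: (d2_ge inc lb (e := eps / 20)) => //; first lra.
    move=> n; rewrite exprMn [X in _ * X]mulrCA rsqr; have /andP[h1 h2] := ha n.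
    rewrite /mu in h1; rewrite /lam in h2.
    have h3 : 1 - 3 / 25 * eps <= (1 - eps / 20) * (1 - 7 * (eps / 200)) ^+ 2 by nra.
    have a0 : 0 <= a n by lra.
    have := ler_wpM2r a0 h3; nra.
  apply: (d2_le inc _ ub); first exact: tame_q0 T 0%N.
  move=> n; rewrite exprMn mulrCA rsqr; have /andP[h1 h2] := ha n.+1.
  rewrite /mu in h1; rewrite /lam in h2.
  have h3 : (1 + 12 * (eps / 200)) ^+ 2 <= 1 + 13 / 100 * eps by nra.
  have a0 : 0 <= a n.+1 by lra.
  have := ler_wpM2r a0 h3; nra.
have ZL n : (1 + 12 * (eps / 200)) * tame_radius q a n.+1 <
    (1 - 7 * (eps / 200)) * tame_radius q a n.
  have := rstep n; have := rgt0 n; have := rgt0 n.+1; nra.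
apply: le_lt_trans (m_ratio_le inc (tame_q0 T 0%N)
  (tame_ratio T mu0 lam_mu K0_24) ub lb ZL thQ) _.
rewrite lte_fin -exprVn.
(* Here [eps < lambda] enters, through [mu > eps / 4]. The resulting constant is [3 * (201^2 + 16)],
   below [10^6]. *)
have imu : mu^-1 <= 4 * eps^-1.
  rewrite -[4 * _]invrK lef_pV2 ?posrE ?invr_gt0 ?mulr_gt0 // invfM invrK /mu; lra.
have imu0 : 0 < mu^-1 by rewrite invr_gt0.
have h1 : mu^-1 ^+ 2 <= 16 * eps^-1 ^+ 2 by nra.
have h2 : (K0 + 1) ^+ 2 <= 201 ^+ 2 * eps^-1 ^+ 2 by rewrite /K0; nra.
have : 0 < eps^-1 ^+ 2 by rewrite exprn_gt0.
lra.
Qed.
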